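(* Let $\boldsymbol x\mid c$ be elliptical on $\mathbb R^d$ with parameters $(\boldsymbol\mu_c,\Sigma_c,g_c)$, $\Sigma_c\succ0$, $g_c>0$, and let $T_c=D_c^2(\boldsymbol x)=(\boldsymbol x-\boldsymbol\mu_c)^{\mathsf T}\Sigma_c^{-1}(\boldsymbol x-\boldsymbol\mu_c)$. Then the within-class law of $T_c$ (its law when $\boldsymbol x$ is drawn from class $c$) has density $$f_{T_c}(t)=\frac{\omega_d}{2}\,t^{d/2-1}g_c(t),\qquad t>0,\qquad \omega_d=\frac{2\pi^{d/2}}{\Gamma(d/2)} .$$ Hence, once the elliptical scale is fixed by $\Sigma_c$, the generator $g_c$, and the radial link $\varphi_c=\log g_c$, is identified from the law of $T_c$, up to an additive constant for the decision rule: $$\varphi_c(t)=\log f_{T_c}(t)-(d/2-1)\log t+\mathrm{const}.$$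
   Context: A random vector is elliptical on $\mathbb R^d$ with location $\boldsymbol\mu_c$, scatter $\Sigma_c\succ0$ and radial generator $g_c>0$ if its density is $p_c(\boldsymbol x)=|\Sigma_c|^{-1/2}g_c\big((\boldsymbol x-\boldsymbol\mu_c)^{\mathsf T}\Sigma_c^{-1}(\boldsymbol x-\boldsymbol\mu_c)\big)$. The scale indeterminacy, by which $(\Sigma,g(\cdot))$ and $(s\Sigma,s^{d/2}g(s\,\cdot))$, $s>0$, give the same density, is resolved by regarding $\Sigma_c$ as given. The decision rule is the Bayes rule based on the sign of the log-likelihood ratio, which in the common-link case involves the link only through a difference of its values. *)

(* Defs.v *)
From HB Require Import structures.
From mathcomp Require Import all_boot all_order all_algebra.
From mathcomp Require Import all_classical all_reals all_analysis.

Set Implicit Arguments.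
Unset Strict Implicit.
Unset Printing Implicit Defensive.

Import Order.TTheory GRing.Theory Num.Theory.
Import numFieldNormedType.Exports.

Local Open Scope classical_set_scope.
Local Open Scope ring_scope.

Section tcons_measure.
Context {R : realType} (n : nat).

Definition tcons (p : measurableTypeR R * n.-tuple (measurableTypeR R)) :
  n.+1.-tuple (measurableTypeR R) := [tuple of p.1 :: p.2].

Definition tuncons (v : n.+1.-tuple (measurableTypeR R)) :
  measurableTypeR R * n.-tuple (measurableTypeR R) :=
  (tnth v ord0, [tuple of behead v]).

Lemma tconsK : cancel tcons tuncons.
Proof. by move=> [x v]; congr pair; apply/val_inj. Qed.

Lemma measurable_tcons : measurable_fun [set: _] tcons.
Proof. by apply: measurable_cons. Qed.

Lemma measurable_tuncons : measurable_fun [set: _] tuncons.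
Proof.
by apply: measurable_fun_pair; [exact: measurable_tnth|exact: measurable_behead].
Qed.

Variable m : {sigma_finite_measure set (n.-tuple (measurableTypeR R)) -> \bar R}.

Definition tcons_measure : set (n.+1.-tuple (measurableTypeR R)) -> \bar R :=
  pushforward (@lebesgue_measure R \x m)%E tcons.

Let tcons_measure0 : tcons_measure set0 = 0%E.
Proof. by rewrite /tcons_measure /pushforward preimage_set0 measure0. Qed.

Let tcons_measure_ge0 A : (0 <= tcons_measure A)%E.
Proof. by rewrite /tcons_measure /pushforward measure_ge0. Qed.

Let tcons_measure_sigma_additive : semi_sigma_additive tcons_measure.
Proof.
have mt A : measurable A -> measurable (tcons @^-1` A).
  by move=> mA; rewrite -[X in measurable X]setTI; exact: measurable_tcons.
move=> F mF tF mUF; rewrite /tcons_measure /pushforward preimage_bigcup.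
apply: measure_semi_sigma_additive.
- by move=> i; exact: mt.
- apply/trivIsetP => i j _ _ ij; rewrite -preimage_setI.
  by move/trivIsetP : tF => /(_ _ _ _ _ ij) ->//; rewrite preimage_set0.
- by rewrite -preimage_bigcup; exact: mt.
Qed.

HB.instance Definition _ := isMeasure.Build _ _ _ tcons_measure
  tcons_measure0 tcons_measure_ge0 tcons_measure_sigma_additive.

Let tcons_measure_sigma_finite : sigma_finite setT tcons_measure.
Proof.
have /sigma_finiteP[F [TF ndF Foo]] := sigma_finiteT (@lebesgue_measure R).
have /sigma_finiteP[G [TG ndG Goo]] := sigma_finiteT m.
exists (fun i => tuncons @^-1` (F i `*` G i)).
  rewrite -preimage_bigcup (_ : \bigcup_i _ = setT) ?preimage_setT//.
  rewrite -setXTT TF TG; apply/seteqP; split=> [x [k _ [? ?]]|[x y]/=].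
    by split; exists k.
  move=> [[k _ Fx] [l _ Gy]]; exists (maxn k l) => //; split.
  - by move: x Fx; exact/subsetPset/ndF/leq_maxl.
  - by move: y Gy; exact/subsetPset/ndG/leq_maxr.
move=> i; have [mF Fi] := Foo i; have [mG Gi] := Goo i; split.
  rewrite -[X in measurable X]setTI.
  by apply: measurable_tuncons => //; exact: measurableX.
rewrite /tcons_measure /pushforward -comp_preimage.
rewrite (_ : tuncons \o tcons = id); last by apply/funext => p /=; rewrite tconsK.
by rewrite preimage_id product_measure1E// lte_mul_pinfty// ge0_fin_numE.
Qed.

HB.instance Definition _ := Measure_isSigmaFinite.Build _ _ _ tcons_measure
  tcons_measure_sigma_finite.

End tcons_measure.

(* Lebesgue measure on the Borel sets of R^n, with R^n represented by tuples to
   use their product sigma-algebra; [lebesgue_tuple_box] characterizes it. *)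
Fixpoint lebesgue_tuple (R : realType) (n : nat) :
    {sigma_finite_measure set (n.-tuple (measurableTypeR R)) -> \bar R} :=
  if n is n'.+1 then tcons_measure (lebesgue_tuple R n')
  else \d_[tuple].

Lemma lebesgue_tuple_box (R : realType) (n : nat)
    (A : 'I_n -> set (measurableTypeR R)) : (forall i, measurable (A i)) ->
  lebesgue_tuple R n [set v | forall i, A i (tnth v i)] =
  (\prod_(i < n) lebesgue_measure (A i))%E.
Proof.
elim: n A => [|n IH] A mA.
  by rewrite big_ord0 /= diracE mem_set// => -[].
rewrite big_ord_recl -IH; last by move=> i.
rewrite -product_measure1E//; last first.
  rewrite (_ : [set _ | _] =
    \bigcap_(i in [set: 'I_n]) ((@tnth n _) ^~ i @^-1` A (lift ord0 i))); last first.
    by apply/seteqP; split=> v /= h i *; exact: h.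
  apply: fin_bigcap_measurable => // i _.
  by rewrite -[X in measurable X]setTI; exact: measurable_tnth.
congr (product_measure1 _ _ _); apply/seteqP; split=> -[x v] /=.
  by move=> h; split=> [|i]; [exact: (h ord0)|have := h (lift ord0 i); rewrite tnthS].
move=> [h0 h] i; have [j ->|->] := unliftP ord0 i; last exact: h0.
by rewrite tnthS; exact: h.
Qed.

Section elliptical.
Context {R : realType}.

Definition Gamma (a : R) : R :=
  \int[lebesgue_measure]_(t in `]0%R, +oo[) (t `^ (a - 1) * expR (- t)).

Definition omega (d : nat) : R :=
  2 * pi `^ (d%:R / 2) / Gamma (d%:R / 2).

(* This forces [law] to put no mass outside [D], and ignores the values of [f]
   there. [f] is determined only up to a [nu]-null subset of [D]. *)
Definition density_on {dT} {T : measurableType dT} (nu : set T -> \bar R)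
    (D : set T) (law : set T -> \bar R) (f : T -> R) : Prop :=
  [/\ measurable_fun D f, (forall x, D x -> 0 <= f x) &
      forall A, measurable A -> law A = (\int[nu]_(x in A `&` D) (f x)%:E)%E].

Definition posdefmx {d : nat} (S : 'M[R]_d) : Prop :=
  S^T = S /\ forall v : 'cV[R]_d, v != 0 -> 0 < (v^T *m S *m v) 0 0.

Definition sqmahalanobis {d : nat} (mu : 'cV[R]_d) (S : 'M[R]_d)
    (x : d.-tuple (measurableTypeR R)) : R :=
  let v := (\col_i tnth x i) - mu in (v^T *m invmx S *m v) 0 0.

Definition elliptical_density {d : nat} (mu : 'cV[R]_d) (S : 'M[R]_d)
    (g : R -> R) (x : d.-tuple (measurableTypeR R)) : R :=
  (\det S) `^ (- 2^-1) * g (sqmahalanobis mu S x).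

(* A generator is a function on [0, +oo[; its values at negative arguments are
   never used. *)
Definition elliptical {d : nat}
    (law : set (d.-tuple (measurableTypeR R)) -> \bar R)
    (mu : 'cV[R]_d) (S : 'M[R]_d) (g : R -> R) : Prop :=
  [/\ posdefmx S, measurable_fun `[(0 : R), +oo[ g, (forall t, 0 <= t -> 0 < g t) &
      density_on (lebesgue_tuple R d) setT law (elliptical_density mu S g)].

Definition sqmahalanobis_density (d : nat) (g : R -> R) (t : R) : R :=
  omega d / 2 * t `^ (d%:R / 2 - 1) * g t.

Definition radial_link (g : R -> R) (t : R) : R := ln (g t).

(* The radial link as read off from a density [f] of the squared distance. *)
Definition recovered_link (d : nat) (f : R -> R) (t : R) : R :=
  ln (f t) - (d%:R / 2 - 1) * ln t.

(* 1: the class with density [p1]; -1: the class with density [p0]; 0: a tie. *)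
Definition bayes_rule {T : Type} (p0 p1 : T -> R) (x : T) : R :=
  Num.sg (ln (p1 x) - ln (p0 x)).

(* [expR \o phi] need not be normalized: a common constant factor cancels. *)
Definition common_link_rule {d : nat} (mu0 : 'cV[R]_d) (S0 : 'M[R]_d)
    (mu1 : 'cV[R]_d) (S1 : 'M[R]_d) (phi : R -> R) :
    d.-tuple (measurableTypeR R) -> R :=
  bayes_rule (elliptical_density mu0 S0 (expR \o phi))
             (elliptical_density mu1 S1 (expR \o phi)).

End elliptical.

(* Main.v *)
Require Import Defs.
From HB Require Import structures.
From mathcomp Require Import all_boot all_order all_algebra.
From mathcomp Require Import all_classical all_reals all_analysis.
From mathcomp Require Import measurable_realfun ring.

Set Implicit Arguments.
Unset Strict Implicit.
Unset Printing Implicit Defensive.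

Import Order.TTheory GRing.Theory Num.Theory.
Import numFieldNormedType.Exports.

Local Open Scope classical_set_scope.
Local Open Scope ring_scope.

(** Everything follows from one formula, [ge0_integral_qform]: the image of
    Lebesgue measure on R^n under the quadratic form q(x) = (x - m)^T A (x - m),
    with A positive definite, has density
    (omega_n / 2) (det A)^(-1/2) t^(n/2 - 1) on ]0, +oo[. Homogeneity gives the
    shape of this density and one Gaussian integral gives its constant, which
    replaces polar coordinates and the linear change of variables.

    Homogeneity. The dilation of ratio s about m multiplies q by s^2 and Lebesgue
    measure by s^n ([lebesgue_tuple_affine], a coordinatewise statement), so the
    volume of {q <= b} is K b^(n/2), where K is the volume of {q <= 1}. As
    K b^(n/2) is also the integral of K (n/2) t^(n/2 - 1) over ]0, b]
    ([integral_powR_itv]), and as a measure on the line is determined by its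
    values on the rays ]-oo, b] when these are finite ([measure_rays_unique]),
    the image measure is K (n/2) t^(n/2 - 1) dt.

    Normalization. Integrating exp(-t) against the image measure gives
    K (n/2) Gamma(n/2); it is also the Gaussian integral of exp(-q), equal to
    sqrt(pi^n / det A) ([integral_gauss_qform]). The latter is proved by
    induction on n: completing the square in the first coordinate splits q into
    a one-dimensional square and the form of the Schur complement, whose
    determinant is det A divided by the first pivot. Comparing the two values
    gives K, and shows that Gamma(n/2) is positive and finite.

    For A the inverse of the scatter matrix, the determinant factor cancels
    against the one in the elliptical density, which gives the density of the
    squared distance ([elliptical_sqmahalanobis_density]). Densities of a finite
    law are unique almost everywhere ([density_on_ae_unique]), hence so is the
    generator, its coefficient being positive on ]0, +oo[; the link is recovered
    up to -ln(omega_d / 2). In the decision rule this constant cancels from the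
    log-likelihood ratio ([common_link_ruleE]), and the exceptional null set of
    distances pulls back to a null set of R^d because the image of Lebesgue measure
    is absolutely continuous ([sqmahalanobis_null]). *)

(** * Measures given by a density *)

Section integral_density.
Import HBNNSimple.

(** Linearity reduces the formula to indicators, where it is the hypothesis, and
    monotone convergence extends it from simple functions to all of them. *)
Lemma ge0_integral_density {d} {T : measurableType d} {R : realType}
    (mu nu : {measure set T -> \bar R}) (k : T -> R) (f : T -> \bar R) :
  measurable_fun setT k -> (forall x, 0 <= k x) ->
  (forall A, measurable A -> nu A = (\int[mu]_(x in A) (k x)%:E)%E) ->
  measurable_fun setT f -> (forall x, 0 <= f x)%E ->
  (\int[nu]_x f x = \int[mu]_x (f x * (k x)%:E))%E.
Proof.
move=> mk k0 nuE mf f0.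
have sfun (h : {nnsfun T >-> R}) :
    (\int[nu]_x (h x)%:E = \int[mu]_x ((h x)%:E * (k x)%:E))%E.
  under eq_integral do rewrite fimfunE -fsumEFin//.
  rewrite ge0_integral_fsum//; last 2 first.
  - by move=> r; exact/measurable_EFinP/measurable_funM.
  - by move=> r x _; rewrite nnfun_muleindic_ge0.
  under [RHS]eq_integral => x _.
    rewrite fimfunE -fsumEFin// ge0_mule_fsuml; last first.
      by move=> r; exact: (nnfun_muleindic_ge0 h r).
    over.
  rewrite ge0_integral_fsum//; last 2 first.
  - move=> r; apply: emeasurable_funM; last exact/measurable_EFinP.
    exact/measurable_EFinP/measurable_funM.
  - by move=> r x _; rewrite mule_ge0 ?lee_fin//; exact: (nnfun_muleindic_ge0 h r).
  apply: eq_fsbigr => r _.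
  rewrite integralZl_indic_nnsfun// integral_indic// setIT nuE//.
  have [r0|r0] := ltP r 0.
    rewrite preimage_nnfun0// integral_set0 mule0 integral0_eq// => x _.
    by rewrite indicE in_set0 mulr0 mul0e.
  rewrite integral_mkcond -ge0_integralZl//.
  - apply: eq_integral => x _; rewrite patchE indicE.
    by case: ifP => _; rewrite ?mulr1 // mulr0 mul0e mule0.
  - apply/(measurable_restrictT _ _).1 => //.
    exact/measurable_EFinP/measurable_funTS.
  - by move=> x _; rewrite patchE; case: ifP => // _; rewrite lee_fin.
pose f_ := nnsfun_approx measurableT mf.
transitivity (limn (fun n => \int[nu]_x (f_ n x)%:E))%E.
  rewrite -monotone_convergence//.
  - apply: eq_integral => y _; apply/esym/cvg_lim => //.
    exact: cvg_nnsfun_approx.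
  - by move=> n; exact/measurable_EFinP.
  - by move=> n y _; rewrite lee_fin.
  - by move=> y _ m n mn; rewrite lee_fin; exact/lefP/nd_nnsfun_approx.
under eq_fun do rewrite sfun.
rewrite -monotone_convergence//.
- apply: eq_integral => y _; apply/cvg_lim => //.
  apply: cvgeZr; last exact: cvg_nnsfun_approx.
  by [].
- by move=> n; apply: emeasurable_funM; exact/measurable_EFinP.
- by move=> n y _; rewrite mule_ge0 ?lee_fin.
- move=> y _ m n mn; apply: lee_wpmul2r; first by rewrite lee_fin.
  by rewrite lee_fin; exact/lefP/nd_nnsfun_approx.
Qed.

End integral_density.

Section density_measure.
Context {d} {T : measurableType d} {R : realType}.
Variables (mu : {measure set T -> \bar R}) (k : T -> R).
Hypotheses (mk : measurable_fun setT k) (k0 : forall x, 0 <= k x).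

Definition density_measure (A : set T) : \bar R := (\int[mu]_(x in A) (k x)%:E)%E.

Let density_measure0 : density_measure set0 = 0%E.
Proof. exact: integral_set0. Qed.

Let density_measure_ge0 A : (0 <= density_measure A)%E.
Proof. by apply: integral_ge0 => x _; rewrite lee_fin. Qed.

Let density_measure_sigma_additive : semi_sigma_additive density_measure.
Proof.
move=> F mF tF mUF; rewrite /density_measure; apply: cvg_toP.
  apply: ereal_nondecreasing_is_cvgn => p q pq.
  apply: lee_sum_nneg_natr => // i _ _.
  by apply: integral_ge0 => x _; rewrite lee_fin.
rewrite ge0_integral_bigcup//=.
  by apply/measurable_EFinP; exact: measurable_funTS.
by move=> x _; rewrite lee_fin.
Qed.

HB.instance Definition _ := isMeasure.Build _ _ _ density_measure
  density_measure0 density_measure_ge0 density_measure_sigma_additive.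

End density_measure.

(** Two densities have the same integral over every measurable part of [D], and
    finiteness of the law makes them integrable. *)
Lemma density_on_ae_unique {dT} {T : measurableType dT} {R : realType}
    (nu : {measure set T -> \bar R}) (D : set T) (law : set T -> \bar R)
    (f1 f2 : T -> R) :
  measurable D -> (law setT < +oo)%E ->
  density_on nu D law f1 -> density_on nu D law f2 ->
  {ae nu, forall x, D x -> f1 x = f2 x}.
Proof.
move=> mD lawT [mf1 f10 law1] [mf2 f20 law2].
have : ae_eq nu D (EFin \o f1) (EFin \o f2).
  apply: integral_ae_eq => //.
  - apply/integrableP; split; first exact/measurable_EFinP.
    rewrite (_ : integral _ _ _ = law setT)// law1// setTI.
    by apply: eq_integral => x; rewrite inE /= => /f10 f1x; rewrite ger0_norm.
  - exact/measurable_EFinP.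
  - move=> E ED mE; have /esym EE : E `&` D = E by exact/setIidPl.
    by rewrite EE -law1// -law2.
by apply: filterS => x fE /fE[].
Qed.

(** * Measures on the real line *)

Section real_measures.
Context {R : realType}.
Local Notation mu := (@lebesgue_measure R).

(** Differences of rays are the half-open intervals, a pi-system generating the
    Borel sets. *)
Lemma measure_rays_unique (m1 m2 : {measure set (measurableTypeR R) -> \bar R}) :
  (forall b, m1 `]-oo, b]%classic < +oo)%E ->
  (forall b, m1 `]-oo, b]%classic = m2 `]-oo, b]%classic) ->
  forall A, measurable A -> m1 A = m2 A.
Proof.
move=> fin1 eq12 A mA.
have fin2 b : (m2 `]-oo, b]%classic < +oo)%E by rewrite -eq12.
have mray b : measurable (`]-oo, b]%classic : set (measurableTypeR R)).
  exact: measurable_itv.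
have ocE (a b : R) : `]a, b]%classic = `]-oo, b]%classic `\` `]-oo, a]%classic.
  apply/seteqP; split => x /=; rewrite !in_itv/=.
    by move=> /andP[ax ->]; split => //; apply/negP; rewrite -ltNge.
  by move=> [-> /negP]; rewrite -ltNge => ->.
have interE (a b : R) :
    `]-oo, b]%classic `&` `]-oo, a]%classic = `]-oo, Num.min a b]%classic.
  apply/seteqP; split => x /=; rewrite !in_itv/= le_min.
    by move=> [-> ->].
  by move=> /andP[-> ->].
apply: (@measure_unique _ R (measurableTypeR R) (@ocitv R)
  (fun n : nat => `](- n%:R), n%:R]%classic) _ _ _ _ m1 m2) => //.
- exact: ocitvI.
- by move=> i; exists (- i%:R, i%:R).
- by rewrite bigcup_itvT.
- move=> _ [[a b] _ <-] /=.
  rewrite ocE !measureD ?interE//; [|exact: fin2|exact: fin1].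
  by congr (_ - _)%E; exact: eq12.
- move=> n; apply: le_lt_trans (fin1 n%:R); apply: le_measure; rewrite ?inE//.
  by move=> x /=; rewrite !in_itv/= => /andP[].
Qed.

(** For [a < 1] the integrand is unbounded at 0, so the fundamental theorem of
    calculus is applied on [[b / (n + 2), b]] and [n] tends to infinity. *)
Lemma integral_powR_itv (a b : R) : 0 < a -> 0 < b ->
  (\int[mu]_(t in `]0%R, b]) (a * t `^ (a - 1))%:E = (b `^ a)%:E)%E.
Proof.
move=> a0 b0.
pose e (n : nat) : R := b / n.+2%:R.
have e0 n : 0 < e n by rewrite divr_gt0.
have eb n : e n < b by rewrite ltr_pdivrMr// ltr_pMr// ltr1n.
have powR_cont p x : 0 < x -> {for x, continuous (fun t : R => t `^ p)}.
  move=> x0; apply: differentiable_continuous; apply/derivable1_diffP.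
  by apply: derivable_powR; rewrite in_itv/= x0.
have FTC n : (\int[mu]_(t in `[e n, b]) (a * t `^ (a - 1))%:E =
    (b `^ a)%:E - (e n `^ a)%:E)%E.
  apply: (@continuous_FTC2 R _ (fun t => t `^ a)) => //.
  - apply: continuous_in_subspaceT => x; rewrite inE/= in_itv/= => /andP[ex _].
    have x0 : 0 < x by exact: lt_le_trans ex.
    apply: cvgM; first exact: cvg_cst.
    exact: powR_cont.
  - split.
    + move=> x; rewrite in_itv/= => /andP[ex _].
      by apply: derivable_powR; rewrite in_itv/= andbT (lt_trans (e0 n)).
    + by apply: cvg_at_right_filter; exact: powR_cont.
    + by apply: cvg_at_left_filter; exact: powR_cont.
  - move=> x; rewrite in_itv/= => /andP[ex _].
    by apply: powR_derive1; rewrite in_itv/= andbT (lt_trans (e0 n)).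
have e_cvg : e n @[n --> \oo] --> (0 : R).
  rewrite -(mulr0 b); apply: cvgM; first exact: cvg_cst.
  have := @cvg_harmonic R; rewrite -(cvg_shiftn 1).
  by under eq_fun do rewrite /= addn1.
have bigE : \bigcup_n `[e n, b]%classic = `]0, b]%classic.
  apply/seteqP; split => x /=.
    move=> [n _]; rewrite /= !in_itv/= => /andP[ex ->].
    by rewrite (lt_le_trans (e0 n)).
  rewrite in_itv/= => /andP[x0 xb].
  have [n _ /(_ n (leqnn n)) /= en] : \forall n \near \oo, e n <= x.
    by apply: cvgr_le e_cvg _ _.
  by exists n => //; rewrite /= in_itv/= en xb.
have H1 : (\int[mu]_(t in `[e n, b]) (a * t `^ (a - 1))%:E @[n --> \oo] -->
    \int[mu]_(t in `]0%R, b]) (a * t `^ (a - 1))%:E)%E.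
  rewrite -bigE; apply: ge0_nondecreasing_set_cvg_integral => //.
  - apply/nondecreasing_seqP => n; rewrite subsetEset => x /=.
    rewrite !in_itv/= => /andP[ex ->]; rewrite andbT (le_trans _ ex)//.
    by rewrite ler_pM2l// lef_pV2 ?posrE// ler_nat.
  - by move=> n; apply/measurable_EFinP; apply: measurable_funTS;
      apply: measurable_funM.
  - by move=> n x _; rewrite lee_fin mulr_ge0 ?powR_ge0// ltW.
have H2 : ((b `^ a)%:E - (e n `^ a)%:E @[n --> \oo] --> (b `^ a)%:E)%E.
  under eq_fun do rewrite -EFinB.
  apply: cvg_EFin; first exact: nearW.
  rewrite [X in _ --> X](_ : _ = b `^ a - 0); last by rewrite subr0.
  apply: cvgB; first exact: cvg_cst.
  have /cvg_at_rightP := @powR_cvg0 R a a0; apply.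
  by split.
move: H1; rewrite (_ : (fun n => _) = (fun n => (b `^ a)%:E - (e n `^ a)%:E)%E).
  by move=> H1; exact: cvg_unique H1 H2.
by apply/funext => n; exact: FTC.
Qed.

(** A point of disagreement would have a whole ball of them, of positive measure. *)
Lemma ae_eq_continuous_eq (f g : R -> R) :
  {ae mu, forall t, 0 < t -> f t = g t} ->
  {within `]0%R, +oo[, continuous f} -> {within `]0%R, +oo[, continuous g} ->
  forall t, 0 < t -> f t = g t.
Proof.
move=> [B [mB B0 NB]] cf cg t t0; apply/eqP/negPn/negP => fg.
have oD : open (`]0%R, +oo[%classic : set R) by exact: interval_open.
have tD : t \in (`]0%R, +oo[%classic : set R) by rewrite inE/= in_itv/= t0.
move: cf cg; rewrite !continuous_open_subspace// => /(_ t tD) cf /(_ t tD) cg.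
have fg0 : \forall x \near t, f x - g x != 0.
  by apply: (cvgr_neq0 _ (cvgB cf cg)); rewrite subr_eq0.
have : \forall x \near t, f x - g x != 0 /\ 0 < x.
  by apply: filterI => //; exact: lt_nbhsr.
move=> /nbhs_ballP[e /= e0 be].
have : (mu (ball t e) <= mu B)%E.
  apply: le_measure; rewrite ?inE//; first exact: measurable_ball.
  move=> x /be[fgx x0]; apply: NB => /= /(_ x0) E.
  by move: fgx; rewrite E subrr eqxx.
by rewrite B0 lebesgue_measure_ball ?(ltW e0)// lee_fin leNgt mulrn_wgt0.
Qed.

End real_measures.

(** * Lebesgue measure on tuples *)

Section lebesgue_tuple_theory.
Context {R : realType}.
Local Notation mu := (@lebesgue_measure R).
Local Notation lam := (lebesgue_tuple R).

Lemma ge0_integral_lebesgue_tupleS n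
    (f : n.+1.-tuple (measurableTypeR R) -> \bar R) :
  measurable_fun setT f -> (forall x, 0 <= f x)%E ->
  (\int[lam n.+1]_x f x = \int[lam n]_w \int[mu]_x f (tcons (x, w)))%E.
Proof.
move=> mf f0.
rewrite /= (ge0_integral_pushforward (@measurable_tcons R n)) ?preimage_setT//.
rewrite fubini_tonelli2//; last by move=> x; exact: f0.
exact: measurableT_comp (@measurable_tcons R n).
Qed.

Lemma ge0_integral_affine (s v : R) (G : measurableTypeR R -> \bar R) :
  0 < s -> measurable_fun setT G -> (forall x, 0 <= G x)%E ->
  (s%:E * \int[mu]_x G (s * x + v)%R = \int[mu]_x G x)%E.
Proof.
move=> s0 mG G0.
pose f (x : measurableTypeR R) : measurableTypeR R := s * x + v.
have mf : measurable_fun setT f.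
  by apply: measurable_funD => //; exact: measurable_funM.
pose nu : {measure set (measurableTypeR R) -> \bar R} :=
  mscale (NngNum (ltW s0)) (pushforward mu f).
have nuE A : measurable A -> mu A = nu mf A.
  apply: lebesgue_measure_unique => _ [[a b] /= _ <-].
  rewrite /nu/= /mscale/= /pushforward.
  have -> : f @^-1` `]a, b] = `]((a - v) / s), ((b - v) / s)]%classic.
    apply/seteqP; split => x /=;
      by rewrite !in_itv/= /f ltr_pdivrMr// ler_pdivlMr// ltrBlDr lerBrDr (mulrC x).
  rewrite !lebesgue_measure_itv/= !lte_fin ltr_pM2r ?invr_gt0// ltrD2r.
  case: ifP => _; last by rewrite mule0.
  rewrite -!EFinD -EFinM; congr EFin; field; exact: lt0r_neq0.
rewrite [RHS](eq_measure_integral (nu mf))//; last first.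
  by move=> A mA _; exact: nuE.
rewrite ge0_integral_mscale//=; congr (_ * _)%E.
by rewrite (ge0_integral_pushforward mf) ?preimage_setT.
Qed.

(** One ratio for all coordinates, but a translation for each of them: a dilation
    about [m] of ratio [s] is [tuple_affine s (fun i => (1 - s) * m i 0)]. *)
Definition tuple_affine n (s : R) (v : 'I_n -> R)
    (x : n.-tuple (measurableTypeR R)) : n.-tuple (measurableTypeR R) :=
  [tuple s * tnth x i + v i | i < n].

Lemma measurable_tuple_affine n (s : R) (v : 'I_n -> R) :
  measurable_fun setT (tuple_affine s v).
Proof.
apply/measurable_fun_tnthP => i.
rewrite [X in measurable_fun _ X](_ : _ =
    (fun x : n.-tuple (measurableTypeR R) => s * tnth x i + v i)); last first.
  by apply/funext => x /=; rewrite tnth_mktuple.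
apply: measurable_funD => //; apply: measurable_funM => //.
exact: measurable_tnth.
Qed.

Lemma tuple_affine_tcons n (s : R) (v : 'I_n.+1 -> R) p :
  tuple_affine s v (tcons p) =
  tcons (s * p.1 + v ord0, tuple_affine s (v \o lift ord0) p.2).
Proof.
apply: eq_from_tnth => i; rewrite tnth_mktuple.
by have [j ->|->] := unliftP ord0 i; rewrite ?tnthS ?tnth_mktuple.
Qed.

(** By induction on [n]: the first-coordinate slices of the preimage of [A] are
    preimages of slices of [A] under the affine map of the other coordinates. *)
Lemma lebesgue_tuple_affine n (s : R) (v : 'I_n -> R)
    (A : set (n.-tuple (measurableTypeR R))) : 0 < s -> measurable A ->
  ((s ^+ n)%:E * lam n (tuple_affine s v @^-1` A) = lam n A)%E.
Proof.
move=> s0; elim: n v A => [|n IH] v A mA.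
  rewrite expr0 mul1e (_ : tuple_affine s v @^-1` A = A)//.
  apply/seteqP; split => x; rewrite /preimage/= [tuple_affine s v x]tuple0 [x]tuple0.
    by [].
  by [].
pose B := tcons (n:=n) @^-1` A.
have mB : measurable B.
  by rewrite -[B]setTI; exact: measurable_tcons.
pose G (x : measurableTypeR R) := lam n (xsection B x).
have mG : measurable_fun setT G by exact: measurable_fun_xsection.
have G0 x : (0 <= G x)%E by exact: measure_ge0.
pose f (x : measurableTypeR R) : measurableTypeR R := s * x + v ord0.
have secE x : xsection (tcons (n:=n) @^-1` (tuple_affine s v @^-1` A)) x =
    tuple_affine s (v \o lift ord0) @^-1` (xsection B (f x)).
  apply/seteqP; split => w; rewrite /xsection/= !inE/= /B/=.
    by rewrite tuple_affine_tcons.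
  by rewrite tuple_affine_tcons.
have -> : lam n.+1 (tuple_affine s v @^-1` A) =
    (\int[mu]_x lam n
      (xsection (tcons (n:=n) @^-1` (tuple_affine s v @^-1` A)) x))%E.
  by [].
have -> : lam n.+1 A = (\int[mu]_x G x)%E by [].
under eq_integral do rewrite secE.
rewrite exprSr EFinM -muleA muleCA -ge0_integralZl//.
- rewrite -(@ge0_integral_affine s (v ord0) G)//; congr (_ * _)%E.
  apply: eq_integral => x _; rewrite IH//.
  exact: measurable_xsection.
- under eq_fun do rewrite -secE.
  apply: measurable_fun_xsection.
  rewrite -[X in measurable X]setTI; apply: measurable_tcons => //.
  by rewrite -[X in measurable X]setTI; exact: measurable_tuple_affine.
- by rewrite lee_fin exprn_ge0// ltW.
Qed.

End lebesgue_tuple_theory.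

(** * Positive definite forms and Schur complements *)

Section quadratic_form.
Context {R : realType}.

Definition qform {n} (A : 'M[R]_n) (v : 'cV[R]_n) : R := (v^T *m A *m v) 0 0.

Definition tuple_col {n} (x : n.-tuple (measurableTypeR R)) : 'cV[R]_n :=
  \col_i tnth x i.

Lemma tuple_col_tcons n (x : measurableTypeR R) (w : n.-tuple (measurableTypeR R)) :
  tuple_col (tcons (x, w)) = col_mx x%:M (tuple_col w) :> 'cV[R]_(1 + n).
Proof.
apply/colP => i; rewrite mxE; case: (splitP i) => [j ij|j ij].
  have -> : i = lshift n j by exact/val_inj.
  by rewrite col_mxEu (ord1 j) !mxE mulr1n /tnth/=.
have -> : i = rshift 1 j by exact/val_inj.
rewrite col_mxEd !mxE (_ : rshift 1 j = lift ord0 j) ?tnthS//.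
exact/val_inj.
Qed.

Lemma qform_scale n (A : 'M[R]_n) (s : R) (v : 'cV[R]_n) :
  qform A (s *: v) = s ^+ 2 * qform A v.
Proof.
by rewrite /qform -scalemxAr [(s *: v)^T]linearZ/= -!scalemxAl !mxE mulrA expr2.
Qed.

Definition schur {n} (A : 'M[R]_(1 + n)) : 'M[R]_n :=
  drsubmx A - (A 0 0)^-1 *: (dlsubmx A *m (dlsubmx A)^T).

Section schur_lemmas.
Context {n : nat} (A : 'M[R]_(1 + n)).
Hypothesis pA : posdefmx A.

Let a := A 0 0.
Let b := dlsubmx A.

Lemma posdefmx_pivot_gt0 : 0 < a.
Proof.
have [_ /(_ (delta_mx 0 0))] := pA.
rewrite trmx_delta -rowE -colE !mxE; apply.
by apply/eqP => /matrixP/(_ 0 0); rewrite !mxE/= => /eqP; rewrite oner_eq0.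
Qed.

Let A_block : A = block_mx a%:M b^T b (drsubmx A).
Proof.
rewrite -[LHS]submxK; congr block_mx.
  by rewrite [LHS]mx11_scalar !mxE; congr (_ %:M); congr (A _ _); apply/val_inj.
by rewrite /b trmx_dlsub; case: pA => -> _.
Qed.

(** One step of Gaussian elimination: a lower triangular matrix with unit diagonal
    clears the first column below the pivot. *)
Lemma det_schur : \det A = a * \det (schur A).
Proof.
have a0 := posdefmx_pivot_gt0.
pose L : 'M[R]_(1 + n) := block_mx 1%:M 0 (- a^-1 *: b) 1%:M.
have -> : \det A = \det (L *m A) by rewrite det_mulmx det_lblock !det1 !mul1r.
rewrite [X in L *m X]A_block mulmx_block !mul1mx !mul0mx !addr0.
rewrite -scalemxAl mul_mx_scalar scalerA mulNr mulVf ?gt_eqF// scaleN1r addNr.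
rewrite det_ublock det_scalar1; congr (_ * \det _).
by rewrite /schur -/a -/b addrC -scalemxAl scaleNr.
Qed.

(** Completion of the square in the first coordinate. *)
Lemma qform_schur (x : R) (w : 'cV[R]_n) :
  qform A (col_mx x%:M w) = a * (x + a^-1 * (b^T *m w) 0 0) ^+ 2 + qform (schur A) w.
Proof.
have a0 := posdefmx_pivot_gt0.
rewrite /qform {1}A_block tr_col_mx mul_row_block mul_row_col.
have E : w^T *m b = ((b^T *m w) 0 0)%:M.
  rewrite -mx11_scalar -[LHS]trmxK trmx_mul trmxK.
  by rewrite [LHS]mx11_scalar [RHS]mx11_scalar !mxE.
set y := (b^T *m w) 0 0 in E *.
have E' : b^T *m w = y%:M by rewrite [LHS]mx11_scalar.
rewrite /schur -/a -/b mulmxBr mulmxBl -scalemxAr -scalemxAl !mulmxDl.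
rewrite !mulmxA E -!mulmxA E' !tr_scalar_mx.
rewrite !mul_scalar_mx !mxE/= !mulr1n.
field; exact: lt0r_neq0.
Qed.

(** The first coordinate can be chosen so that the completed square vanishes; what
    is left of the form of [A] is then the form of its Schur complement. *)
Lemma posdefmx_schur : posdefmx (schur A).
Proof.
split.
  rewrite /schur linearB/= linearZ/= trmx_mul trmxK trmx_drsub.
  by case: pA => -> _.
move=> w w0; have [_ /(_ (col_mx (- (a^-1 * (b^T *m w) 0 0))%:M w))] := pA.
rewrite -/(qform _ _) qform_schur addNr expr0n mulr0 add0r; apply.
by rewrite col_mx_eq0 negb_and w0 orbT.
Qed.

End schur_lemmas.
End quadratic_form.

(** * Gaussian integrals *)

Section gauss.
Context {R : realType}.
Local Notation mu := (@lebesgue_measure R).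
Local Notation lam := (lebesgue_tuple R).

Lemma integral_gauss_shift (a m : R) : 0 < a ->
  (\int[mu]_x (expR (- (a * (x - m) ^+ 2)))%:E = (Num.sqrt (pi / a))%:E)%E.
Proof.
move=> a0.
(* The integrand is proportional to the normal density of variance 1 / (2 a). *)
pose s : R := Num.sqrt (a *+ 2)^-1.
have s2 : s ^+ 2 = (a *+ 2)^-1 by rewrite sqr_sqrtr// invr_ge0 mulrn_wge0// ltW.
have s0 : s != 0 by rewrite sqrtr_eq0 -ltNge invr_gt0 mulrn_wgt0.
have peak : normal_peak s = (Num.sqrt (pi / a))^-1.
  rewrite /normal_peak s2; congr (Num.sqrt _)^-1.
  field; exact: lt0r_neq0.
have pdfE x : normal_pdf m s x = (Num.sqrt (pi / a))^-1 * normal_fun m s x.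
  by rewrite /normal_pdf (negbTE s0) -peak.
have p0 : Num.sqrt (pi / a) != 0 by rewrite sqrtr_eq0 -ltNge divr_gt0// pi_gt0.
rewrite -[RHS]mule1 -(integral_normal_pdf m s) -ge0_integralZl//.
- apply: eq_integral => x _; rewrite -EFinM pdfE mulVKf//.
  rewrite /normal_fun s2; congr (expR _)%:E.
  field; exact: lt0r_neq0.
- by apply/measurable_EFinP; exact: measurable_normal_pdf.
- by move=> x _; rewrite lee_fin normal_pdf_ge0.
Qed.

Lemma measurable_qform n (A : 'M[R]_n) (m : 'cV[R]_n) :
  measurable_fun setT
    (fun x : n.-tuple (measurableTypeR R) => qform A (tuple_col x - m)).
Proof.
rewrite (_ : (fun _ => _) = (fun x : n.-tuple (measurableTypeR R) =>
    \sum_j (\sum_i (tnth x i - m i 0) * A i j) * (tnth x j - m j 0))); last first.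
  apply/funext => x; rewrite /qform mxE; apply: eq_bigr => j _; rewrite !mxE.
  by congr (_ * _); apply: eq_bigr => i _; rewrite !mxE.
have mt i : measurable_fun setT
    (fun x : n.-tuple (measurableTypeR R) => tnth x i - m i 0).
  by apply: measurable_funB => //; exact: measurable_tnth.
apply: measurable_sum => j; apply: measurable_funM => //.
by apply: measurable_sum => i; exact: measurable_funM.
Qed.

Lemma qform_ge0 n (A : 'M[R]_n) v : posdefmx A -> 0 <= qform A v.
Proof.
move=> [_ pA]; have [->|/pA/ltW//] := eqVneq v 0.
by rewrite /qform mulmx0 mxE.
Qed.

Lemma posdefmx_det_gt0 n (A : 'M[R]_n) : posdefmx A -> 0 < \det A.
Proof.
elim: n A => [|n IH] A pA; first by rewrite det_mx00.
rewrite (det_schur pA); apply: mulr_gt0; first exact: posdefmx_pivot_gt0.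
exact/IH/posdefmx_schur.
Qed.

Lemma posdefmx_inv n (A : 'M[R]_n) : posdefmx A -> posdefmx (invmx A).
Proof.
move=> pA; have uA : A \in unitmx.
  by rewrite unitmxE unitfE gt_eqF// posdefmx_det_gt0.
have [sA p] := pA; split; first by rewrite trmx_inv sA.
move=> v v0.
have -> : v^T *m invmx A *m v = (invmx A *m v)^T *m A *m (invmx A *m v).
  by rewrite trmx_mul trmx_inv sA -!mulmxA (mulKVmx uA).
apply: p; apply: contra v0 => /eqP/(congr1 (mulmx A)).
by rewrite mulKVmx// mulmx0 => ->.
Qed.

(** Integrating the first coordinate first leaves the factor [sqrt (pi / a)] for the
    pivot [a], whatever the other coordinates: they only move the centre of the
    one-dimensional Gaussian. The rest is the same integral for the Schur
    complement. *)
Lemma integral_gauss_qform n (A : 'M[R]_n) (m : 'cV[R]_n) : posdefmx A ->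
  (\int[lam n]_x (expR (- qform A (tuple_col x - m)))%:E =
   (Num.sqrt (pi ^+ n / \det A))%:E)%E.
Proof.
have mE k (B : 'M[R]_k) (p : 'cV[R]_k) : measurable_fun setT
    (fun x : k.-tuple (measurableTypeR R) =>
      (expR (- qform B (tuple_col x - p)))%:E).
  apply/measurable_EFinP; apply: measurableT_comp => //.
  by apply: measurableT_comp => //; exact: measurable_qform.
elim: n A m => [|n IH] A m pA.
  rewrite integral_dirac//; last exact: mE.
  rewrite diracT mul1e det_mx00 expr0 divr1 sqrtr1.
  by rewrite /qform mxE big_ord0 oppr0 expR0.
have a0 := posdefmx_pivot_gt0 pA.
rewrite ge0_integral_lebesgue_tupleS//.
pose m' : 'cV[R]_n := dsubmx (m : 'cV[R]_(1 + n)).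
have mB (x : R) (w : n.-tuple (measurableTypeR R)) :
    tuple_col (tcons (x, w)) - m =
    col_mx (x - m 0 0)%:M (tuple_col w - m') :> 'cV[R]_(1 + n).
  rewrite tuple_col_tcons; apply/colP => i; rewrite mxE [X in _ + X]mxE.
  case: (splitP i) => [j ij|j ij].
    have -> : i = lshift n j by exact/val_inj.
    rewrite !(@col_mxEu _ 1 n 1) (ord1 j) !mxE/= !mulr1n.
    by congr (_ - m _ _); exact/val_inj.
  have -> : i = rshift 1 j by exact/val_inj.
  by rewrite !(@col_mxEd _ 1 n 1) !mxE.
(* The shift of the centre caused by the other coordinates. *)
pose c (w : n.-tuple (measurableTypeR R)) : R :=
  (A 0 0)^-1 * ((dlsubmx (A : 'M[R]_(1 + n)))^T *m (tuple_col w - m')) 0 0.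
transitivity (\int[lam n]_w ((Num.sqrt (pi / A 0 0))%:E *
    (expR (- qform (schur (A : 'M[R]_(1 + n))) (tuple_col w - m')))%:E))%E.
  apply: eq_integral => w _.
  rewrite -(integral_gauss_shift (m 0 0 - c w) a0) muleC -ge0_integralZl//.
  - apply: eq_integral => x _; rewrite mB (qform_schur pA) -EFinM -expRD.
    congr (expR _)%:E; rewrite -/(c w); ring.
  - apply/measurable_EFinP; apply: measurableT_comp => //.
    apply: measurableT_comp => //; apply: measurable_funM => //.
    by apply: measurable_funX; exact: measurable_funB.
rewrite ge0_integralZl//.
- rewrite IH; last exact: posdefmx_schur.
  rewrite -EFinM -sqrtrM; last by rewrite divr_ge0 ?pi_ge0// ltW.
  congr (Num.sqrt _)%:E; rewrite (det_schur pA) exprS.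
  by rewrite invfM mulrACA.
- exact: mE.
Qed.
End gauss.

(** * The image of Lebesgue measure under a quadratic form *)

Section radial.
Context {R : realType} {n : nat}.
Variables (A : 'M[R]_n) (m : 'cV[R]_n).
Hypotheses (n0 : (0 < n)%N) (pA : posdefmx A).
Local Notation mu := (@lebesgue_measure R).
Local Notation lam := (lebesgue_tuple R n).

Let q (x : n.-tuple (measurableTypeR R)) : measurableTypeR R :=
  qform A (tuple_col x - m).

Let mq : measurable_fun setT q.
Proof. exact: measurable_qform. Qed.

Let ball (r : R) := [set x | q x <= r].

Let mball r : measurable (ball r).
Proof.
rewrite (_ : ball r = q @^-1` `]-oo, r]%classic).
  by rewrite -[X in measurable X]setTI; apply: mq.
by apply/seteqP; split => x; rewrite /ball/= in_itv.
Qed.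

(** Markov inequality: [expR (- q)] is at least [expR (- r)] on the ball. *)
Let ball_lty r : (lam (ball r) < +oo)%E.
Proof.
have mE : measurable_fun setT (fun x => (expR (- q x))%:E).
  apply/measurable_EFinP; apply: measurableT_comp => //.
  exact: measurableT_comp mq.
have : ((expR (- r))%:E * lam (ball r) < +oo)%E.
  apply: (@le_lt_trans _ _ (\int[lam]_x (expR (- q x))%:E)%E); last first.
    by rewrite integral_gauss_qform// ltry.
  rewrite -integral_cst//.
  apply: (@le_trans _ _ (\int[lam]_(x in ball r) (expR (- q x))%:E)%E).
    apply: ge0_le_integral => //.
    - by move=> x _; rewrite lee_fin expR_ge0.
    - exact: measurable_funTS.
    - by move=> x qr; rewrite lee_fin ler_expR lerN2.
  apply: ge0_subset_integral => //.
by rewrite -lte_pdivlMl ?expR_gt0// mulry gtr0_sg ?invr_gt0 ?expR_gt0// mul1e.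
Qed.

Let ball_scale (s : R) : 0 < s ->
  lam (ball (s ^+ 2)) = ((s ^+ n)%:E * lam (ball 1))%E.
Proof.
move=> s0; rewrite -(@lebesgue_tuple_affine R n s (fun i => (1 - s) * m i 0))//.
congr (_ * lam _)%E; apply/seteqP.
have qE x : q (tuple_affine s (fun i => (1 - s) * m i 0) x) = s ^+ 2 * q x.
  rewrite /q -qform_scale; congr (qform A _); apply/colP => i.
  by rewrite !mxE tnth_mktuple; ring.
have s20 : 0 < s ^+ 2 by rewrite exprn_gt0.
split=> x; rewrite /ball/= qE.
  by rewrite -{2}(mulr1 (s ^+ 2)) ler_pM2l.
by rewrite -{2}(mulr1 (s ^+ 2)) ler_pM2l.
Qed.

(** The form is definite, so the ball of radius 0 is a point, that is, a box with
    sides of length 0, at least one of them since [n > 0]. *)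
Let ball0 : lam (ball 0) = 0%E.
Proof.
apply/eqP; rewrite eq_le measure_ge0 andbT.
have -> : ball 0 = [set x | forall i, [set m i 0] (tnth x i)].
  apply/seteqP; split => x; rewrite /ball/=.
    move=> q0 i; have [_ p] := pA.
    have [xm|/p] := eqVneq (tuple_col x - m) 0.
      by move/colP/(_ i): xm; rewrite !mxE => /eqP; rewrite subr_eq0 => /eqP.
    by rewrite ltNge -/(qform _ _) q0.
  move=> xm; rewrite /q (_ : _ - _ = 0); first by rewrite /qform mulmx0 mxE.
  by apply/colP => i; rewrite !mxE xm subrr.
rewrite (@lebesgue_tuple_box R n (fun i => [set m i 0]))//.
by rewrite (bigD1 (Ordinal n0))//= lebesgue_measure_set1 mul0e.
Qed.

Let K : R := fine (lam (ball 1)).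

Let KE : lam (ball 1) = K%:E.
Proof. by rewrite fineK// ge0_fin_numE. Qed.

Let K0 : 0 <= K.
Proof. by rewrite fine_ge0. Qed.

Let n20 : 0 < n%:R / 2 :> R.
Proof. by rewrite divr_gt0// ltr0n. Qed.

(** The derivative of the volume [K * t `^ (n / 2)] of the ball. *)
Let k (t : R) : R := \1_(`]0, +oo[%classic : set R) t *
  (K * (n%:R / 2 * t `^ (n%:R / 2 - 1))).

Let mk : measurable_fun setT (k : measurableTypeR R -> R).
Proof.
apply: measurable_funM; first exact: measurable_indic.
by apply: measurable_funM => //; apply: measurable_funM.
Qed.

Let k0 t : 0 <= k t.
Proof. by rewrite !mulr_ge0 ?powR_ge0 ?(ltW n20). Qed.

Let radial_law B : measurable B ->
  lam (q @^-1` B) = (\int[mu]_(t in B) (k t)%:E)%E.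
Proof.
pose nu1 : {measure set (measurableTypeR R) -> \bar R} := pushforward lam q.
pose nu2 : {measure set (measurableTypeR R) -> \bar R} := density_measure mu k.
have rayE b : q @^-1` `]-oo, b]%classic = ball b.
  by apply/seteqP; split => x; rewrite /ball/= in_itv.
apply: (@measure_rays_unique _ (nu1 mq) (nu2 mk k0)) => b.
  by rewrite /nu1/= /pushforward rayE.
rewrite /nu1 /nu2/= /pushforward /density_measure rayE.
have [b0|b0] := leP b 0.
  transitivity (0 : \bar R)%E.
    apply/eqP; rewrite eq_le measure_ge0 andbT -ball0.
    apply: le_measure; rewrite ?inE// => x; rewrite /ball/= => /le_trans; exact.
  apply/esym/integral0_eq => t /=; rewrite in_itv/= => tb.
  by rewrite /k indicE memNset ?mul0r//= in_itv/= andbT; apply/negP;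
    rewrite -leNgt (le_trans tb).
rewrite -(sqr_sqrtr (ltW b0)) ball_scale ?sqrtr_gt0// KE sqr_sqrtr ?(ltW b0)//.
have -> : Num.sqrt b ^+ n = b `^ (n%:R / 2).
  by rewrite -powR12_sqrt ?(ltW b0)// -powR_mulrn ?powR_ge0// -powRrM mulrC.
rewrite -(integral_powR_itv n20 b0) -ge0_integralZr//.
- rewrite [LHS]integral_mkcond [RHS]integral_mkcond; apply: eq_integral => t _.
  rewrite !patchE /k indicE !mem_setE !in_itv/= andbT.
  case: (ltP 0 t) => t0; case: (t <= b) => //=; rewrite ?mul0r// mul1r -EFinM.
  by rewrite mulrC.
- by apply/measurable_EFinP; apply: measurable_funTS; apply: measurable_funM.
- by move=> t _; rewrite lee_fin mulr_ge0 ?powR_ge0 ?(ltW n20).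
Qed.

Let radial_integral (F : measurableTypeR R -> \bar R) :
  measurable_fun setT F -> (forall t, 0 <= F t)%E ->
  (\int[lam]_x F (q x) =
   \int[mu]_(t in `]0%R, +oo[) (F t * (K * (n%:R / 2 * t `^ (n%:R / 2 - 1)))%:E))%E.
Proof.
move=> mF F0.
have <- : (\int[pushforward lam q]_t F t = \int[lam]_x F (q x))%E.
  by rewrite (ge0_integral_pushforward mq) ?preimage_setT.
pose nu1 : {measure set (measurableTypeR R) -> \bar R} := pushforward lam q.
rewrite (@ge0_integral_density _ _ _ mu (nu1 mq) k)//.
rewrite [RHS]integral_mkcond; apply: eq_integral => t _.
rewrite patchE /k indicE; case: ifP => tD; first by rewrite mul1r.
by rewrite mul0r mule0.
Qed.

Let V : R := Num.sqrt (pi ^+ n / \det A).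

Let V0 : 0 < V.
Proof. by rewrite sqrtr_gt0 divr_gt0 ?exprn_gt0 ?pi_gt0// posdefmx_det_gt0. Qed.

(** The normalization: the integral of [expR (- q)], computed in two ways. *)
Let Gamma_eq : ((K * (n%:R / 2))%:E *
  \int[mu]_(t in `]0%R, +oo[) (t `^ (n%:R / 2 - 1) * expR (- t))%:E = V%:E)%E.
Proof.
rewrite -(integral_gauss_qform m pA) -/q.
rewrite (radial_integral (F := fun t => (expR (- t))%:E))//; last first.
  by apply/measurable_EFinP; apply: measurableT_comp.
rewrite -ge0_integralZl//.
- by apply: eq_integral => t _; rewrite -!EFinM; congr EFin; ring.
- apply/measurable_EFinP; apply: measurable_funTS; apply: measurable_funM => //.
  exact: measurableT_comp.
- by move=> t _; rewrite lee_fin mulr_ge0 ?powR_ge0 ?expR_ge0.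
- by rewrite lee_fin mulr_ge0 ?(ltW n20).
Qed.

Let coef_gt0 : 0 < K * (n%:R / 2).
Proof.
rewrite lt0r mulr_ge0 ?(ltW n20)// andbT; apply/eqP => c0.
by move: Gamma_eq; rewrite c0 mul0e => -[] /eqP; rewrite lt_eqF.
Qed.

(** [Gamma] is the finite part of an integral; the normalization excludes that this
    integral is infinite. *)
Let GammaE : Gamma (n%:R / 2 : R) = V / (K * (n%:R / 2)).
Proof.
have c0 := coef_gt0.
rewrite /Gamma /Rintegral; have := Gamma_eq; set I := integral _ _ _.
case: I => [r| |].
- by move=> [<-]; rewrite /= mulrC mulKf ?gt_eqF.
- by rewrite gt0_muley.
- by rewrite gt0_muleNy.
Qed.

Lemma Gamma_half_gt0 : 0 < Gamma (n%:R / 2 : R).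
Proof. by rewrite GammaE divr_gt0. Qed.

(** The value of [Gamma (n / 2)] just found turns the unknown volume [K] into
    [omega n]. *)
Lemma ge0_integral_qform (F : measurableTypeR R -> \bar R) :
  measurable_fun setT F -> (forall t, 0 <= F t)%E ->
  (\int[lam]_x F (q x) = \int[mu]_(t in `]0%R, +oo[)
     (F t * (omega n / 2 / Num.sqrt (\det A) * t `^ (n%:R / 2 - 1))%:E))%E.
Proof.
move=> mF F0; rewrite radial_integral//; apply: eq_integral => t _.
congr (_ * _%:E)%E; rewrite mulrA; congr (_ * _).
have dA0 : 0 < \det A by exact: posdefmx_det_gt0.
rewrite /omega GammaE /V sqrtrM ?exprn_ge0 ?pi_ge0// sqrtrV ?(ltW dA0)//.
have -> : pi `^ (n%:R / 2) = Num.sqrt (pi ^+ n) :> R.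
  by rewrite -powR12_sqrt ?exprn_ge0 ?pi_ge0// -powR_mulrn ?pi_ge0// -powRrM.
have := coef_gt0; set c := K * _ => c0.
field; rewrite !gt_eqF ?sqrtr_gt0 ?exprn_gt0 ?pi_gt0//.
Qed.

End radial.

(** * The squared Mahalanobis distance under an elliptical law *)

Section elliptical_radial_law.
Context {R : realType} {d : nat}.
Hypothesis d0 : (0 < d)%N.
Local Notation mu := (@lebesgue_measure R).
Local Notation lam := (lebesgue_tuple R d).

Lemma omega_gt0 : 0 < omega d :> R.
Proof.
(* Only the positivity of [Gamma (d / 2)] is at stake; any positive definite
   matrix provides it. *)
have p1 : posdefmx (1%:M : 'M[R]_d).
  split; first by rewrite trmx1.
  move=> v v0; rewrite mulmx1 mxE.
  have [i vi] : exists i, v i 0 != 0.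
    by apply/existsP; apply: contraNT v0 => /existsPn v0; apply/eqP/colP => i;
      rewrite mxE; apply/eqP; rewrite -[_ == _]negbK.
  rewrite (bigD1 i)//= !mxE -expr2 ltr_wpDr//; last by rewrite exprn_even_gt0.
  by apply: sumr_ge0 => j _; rewrite mxE -expr2 sqr_ge0.
by rewrite divr_gt0 ?mulr_gt0 ?powR_gt0 ?pi_gt0// (Gamma_half_gt0 0 d0 p1).
Qed.

Section scatter.
Variables (m : 'cV[R]_d) (S : 'M[R]_d).
Hypothesis pS : posdefmx S.

Lemma measurable_sqmahalanobis :
  measurable_fun setT (sqmahalanobis m S : _ -> measurableTypeR R).
Proof. exact: measurable_qform. Qed.

Lemma sqmahalanobis_ge0 x : 0 <= sqmahalanobis m S x.
Proof. exact/qform_ge0/posdefmx_inv. Qed.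

Lemma ge0_integral_sqmahalanobis (F : measurableTypeR R -> \bar R) :
  measurable_fun setT F -> (forall t, 0 <= F t)%E ->
  (\int[lam]_x F (sqmahalanobis m S x) = \int[mu]_(t in `]0%R, +oo[)
     (F t * (omega d / 2 * (\det S) `^ 2^-1 * t `^ (d%:R / 2 - 1))%:E))%E.
Proof.
move=> mF F0; have dS := posdefmx_det_gt0 pS.
rewrite (ge0_integral_qform m d0 (posdefmx_inv pS))//; apply: eq_integral => t _.
by rewrite det_inv sqrtrV ?(ltW dS)// invrK powR12_sqrt ?(ltW dS).
Qed.

(** Absolute continuity of the image measure, which has no mass outside ]0, +oo[. *)
Lemma sqmahalanobis_null (N : set (measurableTypeR R)) : measurable N ->
  mu (N `&` `]0%R, +oo[%classic) = 0%E -> lam (sqmahalanobis m S @^-1` N) = 0%E.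
Proof.
move=> mN N0.
have mqN : measurable ((sqmahalanobis m S : _ -> measurableTypeR R) @^-1` N).
  by rewrite -[X in measurable X]setTI; exact: measurable_sqmahalanobis.
rewrite -[LHS]/(lam ((sqmahalanobis m S : _ -> measurableTypeR R) @^-1` N)).
rewrite -[X in lam X]setIT -integral_indic//.
transitivity (\int[lam]_x (EFin \o \1_N) (sqmahalanobis m S x))%E.
  by apply: eq_integral => x _.
rewrite ge0_integral_sqmahalanobis//; last 2 first.
- by apply/measurable_EFinP; exact: measurable_indic.
- by move=> t; rewrite /= lee_fin indicE.
transitivity (\int[mu]_(t in N `&` `]0%R, +oo[%classic)
    (omega d / 2 * (\det S) `^ 2^-1 * t `^ (d%:R / 2 - 1))%:E)%E.
  rewrite [LHS]integral_mkcond [RHS]integral_mkcond; apply: eq_integral => t _.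
  rewrite !patchE/= indicE in_setI; case: (t \in N); case: (t \in _) => //=.
    by rewrite mul1e.
  by rewrite mul0e.
apply: null_set_integral => //; first exact: measurableI.
by apply/measurable_EFinP; apply: measurable_funTS; apply: measurable_funM.
Qed.

(** The factor [(\det S) `^ (- 2^-1)] of the elliptical density cancels against the
    factor [(\det S) `^ 2^-1] of the image measure. *)
Lemma elliptical_sqmahalanobis_density
    (law : set (d.-tuple (measurableTypeR R)) -> \bar R) (g : R -> R) :
  elliptical law m S g ->
  density_on mu `]0%R, +oo[
    (pushforward law (sqmahalanobis m S : _ -> measurableTypeR R))
    (sqmahalanobis_density d g).
Proof.
move=> [_ mg g0 [_ _ lawE]]; split.
- apply: measurable_funM.
    by apply: measurable_funTS; apply: measurable_funM.
  apply: measurable_funS mg => // t /=; rewrite !in_itv/= !andbT; exact: ltW.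
- move=> t /=; rewrite in_itv/= andbT => t0.
  have gt := ltW (g0 t (ltW t0)).
  by rewrite mulr_ge0// mulr_ge0 ?powR_ge0// divr_ge0// (ltW omega_gt0).
move=> B mB.
have mqB : measurable ((sqmahalanobis m S : _ -> measurableTypeR R) @^-1` B).
  by rewrite -[X in measurable X]setTI; exact: measurable_sqmahalanobis.
have dS := posdefmx_det_gt0 pS.
(* The generator is only known to be measurable and positive on [0, +oo[, so it
   is cut off elsewhere; the squared distance never leaves that half-line. *)
pose F (t : measurableTypeR R) : \bar R :=
  ((fun t => ((\det S) `^ (- 2^-1) * g t)%:E) \_ (B `&` `[0%R, +oo[)) t.
have F0 t : (0 <= F t)%E.
  rewrite /F patchE; case: ifP => //; rewrite inE/= in_itv/= andbT => -[_ t0].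
  by rewrite lee_fin mulr_ge0 ?powR_ge0// ltW// g0.
have mF : measurable_fun setT F.
  apply/(measurable_restrictT _ _).1; first exact: measurableI.
  apply/measurable_EFinP; apply: measurable_funM => //.
  by apply: measurable_funS mg => //; exact: subIsetr.
rewrite /pushforward lawE// setIT.
transitivity (\int[lam]_x F (sqmahalanobis m S x))%E.
  rewrite integral_mkcond; apply: eq_integral => x _.
  rewrite /F !patchE in_setI.
  have -> : sqmahalanobis m S x \in `[0%R, +oo[%classic.
    by rewrite inE/= in_itv/= sqmahalanobis_ge0.
  by rewrite andbT; congr (if _ then _ else _); apply/idP/idP; rewrite !inE.
rewrite ge0_integral_sqmahalanobis//.
rewrite [LHS]integral_mkcond [RHS]integral_mkcond; apply: eq_integral => t _.
rewrite /F !patchE !in_setI.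
have [tD|tD] := boolP (t \in `]0%R, +oo[%classic); last by rewrite andbF.
have -> : t \in `[0%R, +oo[%classic.
  by move: tD; rewrite !inE/= !in_itv/= !andbT; exact: ltW.
rewrite !andbT; case: ifP => _; last by rewrite mul0e.
rewrite -EFinM /sqmahalanobis_density powRN; congr EFin.
field; exact/lt0r_neq0/powR_gt0.
Qed.

End scatter.
End elliptical_radial_law.

(** * Links and decision rules *)

Section links.
Context {R : realType} {d : nat}.
Hypothesis d0 : (0 < d)%N.

Lemma sqmahalanobis_density_inj (g h : R -> R) (t : R) : 0 < t ->
  sqmahalanobis_density d g t = sqmahalanobis_density d h t -> g t = h t.
Proof.
move=> t0; apply: mulfI; rewrite mulf_neq0// ?gt_eqF ?powR_gt0//.
by rewrite divr_gt0// omega_gt0.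
Qed.

Lemma recovered_link_sqmahalanobis_density (g : R -> R) (t : R) : 0 < t -> 0 < g t ->
  radial_link g t =
  recovered_link d (sqmahalanobis_density d g) t - ln (omega d / 2).
Proof.
move=> t0 g0; have w0 := omega_gt0 (R := R) d0.
rewrite /recovered_link /sqmahalanobis_density /radial_link.
have w20 : 0 < omega d / 2 :> R by rewrite divr_gt0.
have tp : 0 < t `^ (d%:R / 2 - 1) by exact: powR_gt0.
have wtp : 0 < omega d / 2 * t `^ (d%:R / 2 - 1) by exact: mulr_gt0.
rewrite lnM ?posrE// lnM ?posrE// ln_powR.
ring.
Qed.

(** A constant added to the link multiplies both densities by the same positive
    factor, which leaves the log-likelihood ratio unchanged. The hypotheses on
    [phi] are pointwise because a link recovered from a density is known only
    almost everywhere. *)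
Lemma common_link_ruleE (m0 m1 : 'cV[R]_d) (S0 S1 : 'M[R]_d) (g0 g1 phi : R -> R)
    (k : R) x : posdefmx S0 -> posdefmx S1 ->
  0 < g0 (sqmahalanobis m0 S0 x) -> 0 < g1 (sqmahalanobis m1 S1 x) ->
  phi (sqmahalanobis m0 S0 x) = radial_link g0 (sqmahalanobis m0 S0 x) + k ->
  phi (sqmahalanobis m1 S1 x) = radial_link g1 (sqmahalanobis m1 S1 x) + k ->
  common_link_rule m0 S0 m1 S1 phi x =
  bayes_rule (elliptical_density m0 S0 g0) (elliptical_density m1 S1 g1) x.
Proof.
move=> p0 p1 g00 g10 e0 e1.
have dS0 := posdefmx_det_gt0 p0; have dS1 := posdefmx_det_gt0 p1.
rewrite /common_link_rule /bayes_rule /elliptical_density /= e0 e1; congr Num.sg.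
rewrite !lnM ?posrE ?powR_gt0 ?expR_gt0// !expRK /radial_link.
ring.
Qed.

End links.

Theorem lemma3 (R : realType) (d : nat) (d_gt0 : (0 < d)%N)
    (dO : measure_display) (Omega : measurableType dO) (C : Type)
    (P : C -> probability Omega R)
    (X : {mfun Omega >-> d.-tuple (measurableTypeR R)})
    (mu : C -> 'cV[R]_d) (Sigma : C -> 'M[R]_d) (g : C -> R -> R)
    (ellX : forall c,
      elliptical (distribution (P c) X) (mu c) (Sigma c) (g c)) :
  let T c : Omega -> measurableTypeR R := sqmahalanobis (mu c) (Sigma c) \o X in
  let law_T c := pushforward (P c) (T c) in
  let is_pdf law f := density_on lebesgue_measure `]0%R, +oo[ law f in
  [/\ (* the within-class law of T_c *)
      forall c, is_pdf (law_T c) (sqmahalanobis_density d (g c)),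
      (* the generator is identified from the law of T_c, Sigma_c being given *)
      forall c (Q : probability (d.-tuple (measurableTypeR R)) R)
          (nu : 'cV[R]_d) (h : R -> R),
        elliptical Q nu (Sigma c) h ->
        (forall A : set (measurableTypeR R), measurable A ->
          pushforward Q (sqmahalanobis nu (Sigma c) : _ -> measurableTypeR R) A =
          law_T c A) ->
        {ae lebesgue_measure, forall t, 0 < t -> h t = g c t} /\
        ({within `]0%R, +oo[, continuous h} ->
         {within `]0%R, +oo[, continuous (g c)} ->
         forall t, 0 < t -> h t = g c t),
      (* the link in terms of the density of T_c *)
      exists k : R, forall c,
        (forall t, 0 < t -> radial_link (g c) t =
          recovered_link d (sqmahalanobis_density d (g c)) t + k) /\
        (forall f, is_pdf (law_T c) f ->
          {ae lebesgue_measure, forall t, 0 < t ->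
            radial_link (g c) t = recovered_link d f t + k}) &
      (* the decision rule for a common link *)
      forall (c0 c1 : C) (phi : R -> R),
        (forall t, 0 <= t ->
          radial_link (g c0) t = phi t /\ radial_link (g c1) t = phi t) ->
        let bayes := bayes_rule
          (elliptical_density (mu c0) (Sigma c0) (g c0))
          (elliptical_density (mu c1) (Sigma c1) (g c1)) in
        let rule := common_link_rule (mu c0) (Sigma c0) (mu c1) (Sigma c1) in
        (forall (k : R) x, rule (fun t => phi t + k) x = bayes x) /\
        (forall f, is_pdf (law_T c0) f ->
          {ae lebesgue_tuple R d, forall x,
            rule (recovered_link d f) x = bayes x})].
Proof.
move=> T law_T is_pdf.
have pS c : posdefmx (Sigma c) by case: (ellX c).
have g0 c t : 0 <= t -> 0 < g c t by case: (ellX c) => _ _ + _; exact.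
have pdf_T c : is_pdf (law_T c) (sqmahalanobis_density d (g c)).
  exact: (elliptical_sqmahalanobis_density d_gt0 (pS c) (ellX c)).
have law_lty c : (law_T c setT < +oo)%E.
  by rewrite /law_T /pushforward preimage_setT probability_setT ltry.
have mD : measurable (`]0%R, +oo[%classic : set (measurableTypeR R)).
  exact: measurable_itv.
have link_ae c f : is_pdf (law_T c) f ->
    {ae lebesgue_measure, forall t, 0 < t ->
      radial_link (g c) t = recovered_link d f t - ln (omega d / 2)}.
  move=> pf; have := density_on_ae_unique mD (law_lty c) (pdf_T c) pf.
  apply: filterS => t ft t0.
  rewrite (recovered_link_sqmahalanobis_density d_gt0 t0 (g0 c _ (ltW t0))).
  by rewrite /recovered_link ft//= in_itv/= t0.
split.
- exact: pdf_T.
- move=> c Q nu h ellQ QT.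
  have hg : {ae lebesgue_measure, forall t, 0 < t -> h t = g c t}.
    have pQ := elliptical_sqmahalanobis_density d_gt0 (pS c) ellQ.
    have pQ' : is_pdf (law_T c) (sqmahalanobis_density d h).
      case: pQ => ? ? lawQ; split => // A mA; rewrite -lawQ//.
      by rewrite -QT.
    have := density_on_ae_unique mD (law_lty c) pQ' (pdf_T c).
    apply: filterS => t gh t0; apply: (sqmahalanobis_density_inj d_gt0 t0).
    by apply: gh; rewrite /= in_itv/= t0.
  by split => // ch cg; exact: ae_eq_continuous_eq.
- exists (- ln (omega d / 2)) => c; split; last exact: link_ae.
  by move=> t t0; apply: recovered_link_sqmahalanobis_density => //; exact/g0/ltW.
- move=> c0 c1 phi phiE bayes rule; split=> [k x|f pf].
    have q00 := sqmahalanobis_ge0 (mu c0) (pS c0) x.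
    have q10 := sqmahalanobis_ge0 (mu c1) (pS c1) x.
    apply: (common_link_ruleE (k := k)) => //; try exact: g0.
      by case: (phiE _ q00) => -> _.
    by case: (phiE _ q10) => _ ->.
  have [B [mB B0 NB]] := link_ae c0 f pf.
  (* The distances where the link is not recovered: an exceptional null set, and
     the half-line on which no density says anything. *)
  pose N : set (measurableTypeR R) := B `|` `]-oo, 0%R].
  have mN : measurable N by apply: measurableU => //; exact: measurable_itv.
  have N0 : lebesgue_measure (N `&` `]0%R, +oo[%classic) = 0%E.
    apply/eqP; rewrite eq_le measure_ge0 andbT -B0; apply: le_measure.
    - by rewrite inE; exact: measurableI.
    - by rewrite inE.
    - move=> t [[//|]] /=; rewrite !in_itv/= andbT => t1 t2.
      by move: (lt_le_trans t2 t1); rewrite ltxx.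
  pose qN c := (sqmahalanobis (mu c) (Sigma c) : _ -> measurableTypeR R) @^-1` N.
  have mqN c : measurable (qN c).
    by rewrite -[X in measurable X]setTI; exact: measurable_sqmahalanobis.
  have qN0 c : lebesgue_tuple R d (qN c) = 0%E.
    exact: sqmahalanobis_null.
  exists (qN c0 `|` qN c1); split.
  + exact: measurableU.
  + apply/eqP; rewrite eq_le measure_ge0 andbT.
    apply: (le_trans (measureU2 _ _ _)) => //.
    by rewrite [X in (X + _)%E]qN0 [X in (_ + X)%E]qN0 adde0.
  have linkN t : ~ N t -> 0 < t /\
      recovered_link d f t = radial_link (g c0) t + ln (omega d / 2).
    move=> Nt; have t0 : 0 < t.
      by rewrite ltNge; apply/negP => t0; apply: Nt; right; rewrite /= in_itv.
    split=> //; have [/(_ t0)->|Bt] := pselect (0 < t -> radial_link (g c0) t =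
        recovered_link d f t - ln (omega d / 2)); first by rewrite subrK.
    by case: Nt; left; exact: NB.
  move=> x; apply: contra_notP => qx.
  have [/linkN[t0 l0] /linkN[t1 l1]] : ~ N (sqmahalanobis (mu c0) (Sigma c0) x) /\
      ~ N (sqmahalanobis (mu c1) (Sigma c1) x).
    by split => Nx; apply: qx; [left|right].
  apply: (common_link_ruleE (k := ln (omega d / 2))) => //; try exact/g0/ltW.
  rewrite l1; congr (_ + _).
  by case: (phiE _ (ltW t1)) => -> ->.
Qed.
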